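(* Let $S=(Y;S_\alpha)$ be a quasi completely regular semiring, i.e. $S$ is a b-lattice $Y$ of completely Archimedean semirings $S_\alpha$ $(\alpha\in Y)$. Then $\stackrel{*}{\mathscr{J}^{+}}=\stackrel{*}{\mathscr{D}^{+}}$ on $S$.
   Context: A semiring $(S,+,\cdot)$ consists of two semigroups $(S,+)$, $(S,\cdot)$ (addition not assumed commutative; no zero or identity assumed) with $a(b+c)=ab+ac$ and $(b+c)a=ba+ca$ for all $a,b,c\in S$. For a positive integer $n$, $na$ is the $n$-fold sum $a+\dots+a$. An element $a$ is additively regular if $a+x+a=a$ for some $x\in S$; it is completely regular if there is $x\in S$ with $a=a+x+a$, $a+x=x+a$ and $a(a+x)=a+x$. $S$ is quasi completely regular if for every $a\in S$ there is a positive integer $n$ such that $na$ is completely regular; $S$ is additively quasi regular if for every $a\in S$ some $na$ is additively regular (every quasi completely regular semiring is additively quasi regular). $\mathscr{L}^+,\mathscr{R}^+,\mathscr{J}^+$ denote Green's relations of the semigroup $(S,+)$. On an additively quasi regular semiring $S$ and for $a,b\in S$, let $p,q$ be the least positive integers such that $pa$ and $qb$ are additively regular. Then $a\stackrel{*}{\mathscr{L}^{+}}b$ iff $pa\,\mathscr{L}^+\,qb$; $a\stackrel{*}{\mathscr{R}^{+}}b$ iff $pa\,\mathscr{R}^+\,qb$; $a\stackrel{*}{\mathscr{J}^{+}}b$ iff $pa\,\mathscr{J}^+\,qb$. Put $\stackrel{*}{\mathscr{D}^{+}}=\stackrel{*}{\mathscr{L}^{+}}\circ\stackrel{*}{\mathscr{R}^{+}}$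 (that is, $a\stackrel{*}{\mathscr{D}^{+}}b$ iff there is $c\in S$ with $a\stackrel{*}{\mathscr{L}^{+}}c\stackrel{*}{\mathscr{R}^{+}}b$). A b-lattice is a semiring $Y$ such that $(Y,\cdot)$ is a band and $(Y,+)$ is a semilattice. A semiring $S$ is a b-lattice $Y$ of semirings $S_\alpha$ $(\alpha\in Y)$, written $S=(Y;S_\alpha)$, if there is a semiring congruence $\xi$ on $S$ with $S/\xi=Y$ a b-lattice and each $S_\alpha$ is the $\xi$-class mapped onto $\alpha$. A quasi completely regular semiring is completely Archimedean if $\stackrel{*}{\mathscr{J}^{+}}$ is the universal relation on it. It is known that a semiring is quasi completely regular if and only if it is a b-lattice of completely Archimedean semirings. *)

(* Defs.v *)
From mathcomp Require Import all_boot.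
From mathcomp Require Import boolp classical_sets.

Set Implicit Arguments.
Unset Strict Implicit.
Unset Printing Implicit Defensive.

Declare Scope semiring_scope.
Delimit Scope semiring_scope with SR.
Local Open Scope classical_set_scope.

(* Addition need not be commutative and neither a zero nor a one is required,
   so none of the semiring structures of ssralg applies. *)
Record semiring := Semiring {
  carrier :> Type;
  sadd : carrier -> carrier -> carrier;
  smul : carrier -> carrier -> carrier;
  saddA : associative sadd;
  smulA : associative smul;
  smulDr : right_distributive smul sadd;
  smulDl : left_distributive smul sadd }.

Arguments sadd {s} _ _.
Arguments smul {s} _ _.

Notation "x + y" := (sadd x y) : semiring_scope.
Notation "x * y" := (smul x y) : semiring_scope.
Local Open Scope semiring_scope.

(* The n-fold sum a + ... + a. Only meaningful for 0 < n: there being no zero,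
   [nmul 0 a] is the junk value a. *)
Definition nmul (S : semiring) (n : nat) (a : S) : S := iterop n sadd a a.

Definition add_regular (S : semiring) (a : S) : Prop :=
  exists x : S, a + x + a = a.

Definition completely_regular (S : semiring) (a : S) : Prop :=
  exists x : S, [/\ a = a + x + a, a + x = x + a & a * (a + x) = a + x].

Definition quasi_completely_regular (S : semiring) : Prop :=
  forall a : S, exists2 n, (0 < n)%N & completely_regular (nmul n a).

Definition additively_quasi_regular (S : semiring) : Prop :=
  forall a : S, exists2 n, (0 < n)%N & add_regular (nmul n a).

Lemma quasi_completely_regularW (S : semiring) :
  quasi_completely_regular S -> additively_quasi_regular S.
Proof. by move=> qS a; have [n n0 [x [ax _ _]]] := qS a; exists n => //; exists x. Qed.

Section Green.
Variable S : semiring.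
Implicit Types a b c : S.

(* The principal ideals S^1 + a, a + S^1 and S^1 + a + S^1 of (S, +). *)
Definition left_ideal a : set S :=
  [set y | y = a \/ exists s, y = s + a].
Definition right_ideal a : set S :=
  [set y | y = a \/ exists t, y = a + t].
Definition two_sided_ideal a : set S :=
  [set y | [\/ y = a, exists s, y = s + a, exists t, y = a + t
             | exists s t, y = s + a + t]].

Definition Lplus a b : Prop := left_ideal a = left_ideal b.
Definition Rplus a b : Prop := right_ideal a = right_ideal b.
Definition Jplus a b : Prop := two_sided_ideal a = two_sided_ideal b.

Definition least_regular a (p : nat) : Prop :=
  [/\ (0 < p)%N, add_regular (nmul p a)
    & forall m, (0 < m)%N -> add_regular (nmul m a) -> (p <= m)%N].

(* On an additively quasi regular semiring p and q exist, and they are unique,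
   so the existential quantifiers only name them. *)
Definition star (R : S -> S -> Prop) a b : Prop :=
  exists p q, [/\ least_regular a p, least_regular b q
                & R (nmul p a) (nmul q b)].

Definition Lstar := star Lplus.
Definition Rstar := star Rplus.
Definition Jstar := star Jplus.
Definition Dstar a b : Prop := exists2 c, Lstar a c & Rstar c b.

End Green.

Lemma least_regular_ex (S : semiring) (a : S) :
  additively_quasi_regular S -> exists p, least_regular a p.
Proof.
move=> /(_ a) [n n0 rn].
have ex : exists m, (0 < m)%N && `[< add_regular (nmul m a) >].
  by exists n; rewrite n0; apply/asboolP.
case: (ex_minnP ex) => p /andP[p0 /asboolP rp] minp.
by exists p; split=> // m m0 rm; apply: minp; rewrite m0; apply/asboolP.
Qed.

Lemma least_regular_uniq (S : semiring) (a : S) (p q : nat) :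
  least_regular a p -> least_regular a q -> p = q.
Proof.
by move=> [p0 rp minp] [q0 rq minq]; apply/eqP; rewrite eqn_leq minp ?minq.
Qed.

Definition completely_archimedean (S : semiring) : Prop :=
  quasi_completely_regular S /\ forall a b : S, Jstar a b.

Record blattice := BLattice {
  bl_semiring :> semiring;
  bl_mulxx : forall x : bl_semiring, x * x = x;
  bl_addxx : forall x : bl_semiring, x + x = x;
  bl_addC : forall x y : bl_semiring, x + y = y + x }.

Record congruence (S : semiring) (xi : S -> S -> Prop) : Prop := Congruence {
  cong_refl : forall a, xi a a;
  cong_sym : forall a b, xi a b -> xi b a;
  cong_trans : forall a b c, xi a b -> xi b c -> xi a c;
  cong_add : forall a b c d, xi a b -> xi c d -> xi (a + c) (b + d);
  cong_mul : forall a b c d, xi a b -> xi c d -> xi (a * c) (b * d) }.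

(* S/xi = Y is expressed by the universal data of a quotient: a surjective
   homomorphism onto Y, the natural projection, whose kernel is xi. *)
Record blattice_decomposition (S : semiring) (Y : blattice) := Decomposition {
  dec_xi : S -> S -> Prop;
  dec_xi_cong : congruence dec_xi;
  dec_proj : S -> Y;
  dec_projD : forall a b, dec_proj (a + b) = dec_proj a + dec_proj b;
  dec_projM : forall a b, dec_proj (a * b) = dec_proj a * dec_proj b;
  dec_surj : forall alpha : Y, exists a, dec_proj a = alpha;
  dec_projP : forall a b, dec_proj a = dec_proj b <-> dec_xi a b }.

(* The xi-class mapped onto alpha, as a semiring in its own right. *)
Section Component.
Variables (S : semiring) (Y : blattice) (d : blattice_decomposition S Y).
Variable alpha : Y.

Definition component_type := {x : S | dec_proj d x = alpha}.

Lemma component_inj (x y : component_type) : sval x = sval y -> x = y.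
Proof. by case: x y => [x hx] [y hy] /= e; exact: eq_exist. Qed.

Lemma component_addP (x y : component_type) :
  dec_proj d (sval x + sval y) = alpha.
Proof. by rewrite dec_projD (svalP x) (svalP y) bl_addxx. Qed.

Lemma component_mulP (x y : component_type) :
  dec_proj d (sval x * sval y) = alpha.
Proof. by rewrite dec_projM (svalP x) (svalP y) bl_mulxx. Qed.

Definition component_add (x y : component_type) : component_type :=
  exist _ (sval x + sval y) (component_addP x y).
Definition component_mul (x y : component_type) : component_type :=
  exist _ (sval x * sval y) (component_mulP x y).

Lemma component_addA : associative component_add.
Proof. by move=> x y z; apply: component_inj; exact: saddA. Qed.
Lemma component_mulA : associative component_mul.
Proof. by move=> x y z; apply: component_inj; exact: smulA. Qed.
Lemma component_mulDr : right_distributive component_mul component_add.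
Proof. by move=> x y z; apply: component_inj; exact: smulDr. Qed.
Lemma component_mulDl : left_distributive component_mul component_add.
Proof. by move=> x y z; apply: component_inj; exact: smulDl. Qed.

Definition component : semiring :=
  Semiring component_addA component_mulA component_mulDr component_mulDl.

End Component.

(* Main.v *)
(** Only (S, +) matters, and only that some multiple na of each element lies in
    a subgroup of it.  If a = x + b + y and b = u + a + v, then a is fixed by
    e + _ + f with e = x + u and f = v + y, hence by ne + _ + nf for all n >= 1,
    and inverting in the subgroups that contain a multiple of e or of f recovers
    a from u + a on the left and from a + v on the right.  Thus a L (u + a) R b,
    and u + a is regular since a is. *)
Require Import Defs.
From mathcomp Require Import all_boot.
From mathcomp Require Import boolp.

Set Implicit Arguments.
Unset Strict Implicit.
Unset Printing Implicit Defensive.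

Local Open Scope semiring_scope.

Section AdditiveGreen.
Variable S : semiring.
Implicit Types (a b c e f s t x y z : S) (n p q : nat).

Lemma nmulS n a : (0 < n)%N -> nmul n.+1 a = a + nmul n a.
Proof. by case: n. Qed.

Lemma nmulSr n a : (0 < n)%N -> nmul n.+1 a = nmul n a + a.
Proof.
elim: n => // -[|n] IH _ //.
by rewrite nmulS // [in LHS]IH // saddA -nmulS.
Qed.

(** Exposes the last [e], so that an identity element [x + nmul n e] becomes an absorber ending in
    [e] itself. With no zero available, [n = 1] needs its own witness [x]. *)
Lemma nmul_addr_suffix n e x : (0 < n)%N -> exists s, x + nmul n e = s + e.
Proof.
case: n => [//|[|n]] _; first by exists x.
by exists (x + nmul n.+1 e); rewrite nmulSr // saddA.
Qed.

Lemma nmul_addl_prefix n f y : (0 < n)%N -> exists t, nmul n f + y = f + t.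
Proof.
case: n => [//|[|n]] _; first by exists y.
by exists (nmul n.+1 f + y); rewrite nmulS // saddA.
Qed.

Lemma sandwich_iter e f a n :
  a = e + a + f -> (0 < n)%N -> a = nmul n e + a + nmul n f.
Proof.
move=> ea; elim: n => // -[|n] IH _; first exact: ea.
by rewrite [LHS]ea {1}IH // [nmul n.+2 e]nmulS // [nmul n.+2 f]nmulSr // !saddA.
Qed.

(** Since [nmul n e] commutes with its inverse [x], the sum [x + nmul n e] is a left identity for
    [nmul n e], hence for [a], which begins with that multiple. *)
Lemma sandwich_absorbl e f a : quasi_completely_regular S ->
  a = e + a + f -> exists s, a = s + e + a.
Proof.
move=> qS ea; have [n n0 [x [ex cx _]]] := qS e.
have ae := sandwich_iter ea n0.
have [s es] := nmul_addr_suffix e x n0; exists s.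
have xa : x + nmul n e + a = a.
  by rewrite [in LHS]ae !saddA -cx -ex -ae.
by rewrite -es xa.
Qed.

Lemma sandwich_absorbr e f a : quasi_completely_regular S ->
  a = e + a + f -> exists t, a = a + (f + t).
Proof.
move=> qS ea; have [n n0 [y [fy cy _]]] := qS f.
have af := sandwich_iter ea n0.
have [t ft] := nmul_addl_prefix f y n0; exists t.
have ay : a + (nmul n f + y) = a.
  by rewrite [in LHS]af -!saddA cy [nmul n f + _]saddA -fy saddA -af.
by rewrite -ft ay.
Qed.

Lemma Lplus_intro a b s t : b = s + a -> a = t + b -> Lplus a b.
Proof.
move=> ba ab; apply/predeqP => y; split=> -[->|[r ->]].
- by right; exists t.
- by right; exists (r + t); rewrite -saddA -ab.
- by right; exists s.
- by right; exists (r + s); rewrite -saddA -ba.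
Qed.

Lemma Rplus_intro a b s t : b = a + s -> a = b + t -> Rplus a b.
Proof.
move=> ba ab; apply/predeqP => y; split=> -[->|[r ->]].
- by right; exists t.
- by right; exists (t + r); rewrite saddA -ab.
- by right; exists s.
- by right; exists (s + r); rewrite saddA -ba.
Qed.

(** Building the ideal in two stages makes it depend on [a] only through [left_ideal a], so [Lplus]
    implies [Jplus] by rewriting; the mirror version serves [Rplus]. *)
Lemma two_sided_ideal_LR a y :
  two_sided_ideal a y <-> exists2 z, left_ideal a z & right_ideal z y.
Proof.
split=> [[->|[s ->]|[t ->]|[s [t ->]]]|[z [->|[s ->]] [->|[t ->]]]].
- by exists a; left.
- by exists (s + a); [right; exists s|left].
- by exists a; [left|right; exists t].
- by exists (s + a); right; [exists s|exists t].
- exact: Or41.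
- by apply: Or43; exists t.
- by apply: Or42; exists s.
- by apply: Or44; exists s, t.
Qed.

Lemma two_sided_ideal_RL a y :
  two_sided_ideal a y <-> exists2 z, right_ideal a z & left_ideal z y.
Proof.
split=> [[->|[s ->]|[t ->]|[s [t ->]]]|[z [->|[t ->]] [->|[s ->]]]].
- by exists a; left.
- by exists a; [left|right; exists s].
- by exists (a + t); [right; exists t|left].
- by exists (a + t); right; [exists t|exists s; rewrite saddA].
- exact: Or41.
- by apply: Or42; exists s.
- by apply: Or43; exists t.
- by apply: Or44; exists s, t; rewrite saddA.
Qed.

Lemma Lplus_Jplus a b : Lplus a b -> Jplus a b.
Proof. by move=> ab; apply/predeqP => y; rewrite !two_sided_ideal_LR ab. Qed.

Lemma Rplus_Jplus a b : Rplus a b -> Jplus a b.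
Proof. by move=> ab; apply/predeqP => y; rewrite !two_sided_ideal_RL ab. Qed.

(** The idempotents [a + x] and [x + a] fix [a] and fill in for a missing outer summand. *)
Lemma add_regular_two_sided a y : add_regular a ->
  two_sided_ideal a y -> exists s t, y = s + a + t.
Proof.
move=> [x ax] [->|[s ->]|[t ->]|//].
- by exists (a + x), (x + a); rewrite saddA !ax.
- by exists s, (x + a); rewrite -!saddA [a + (x + a)]saddA ax.
- by exists (a + x), t; rewrite ax.
Qed.

Lemma add_regular_Lplus a c s t :
  add_regular a -> c = s + a -> a = t + c -> add_regular c.
Proof.
(* The [t] turns the right-hand [c] back into [a]; then [a + x + a] collapses under the [s] of the
   left-hand [c]. *)
move=> [x ax] ca ac; exists (x + t).
by rewrite -[LHS]saddA -[x + t + c]saddA -ac [in LHS]ca -saddA [a + _]saddA ax.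
Qed.

Lemma Jplus_regular_Dplus a b : quasi_completely_regular S ->
  add_regular a -> add_regular b -> Jplus a b ->
  exists c, [/\ add_regular c, Lplus a c & Rplus c b].
Proof.
move=> qS ra rb ab.
have [x [y axy]] : exists x y, a = x + b + y.
  by apply: add_regular_two_sided => //; rewrite -[two_sided_ideal b]ab; exact: Or41.
have [u [v buv]] : exists u v, b = u + a + v.
  by apply: add_regular_two_sided => //; rewrite [two_sided_ideal a]ab; exact: Or41.
have ea : a = (x + u) + a + (v + y) by rewrite [LHS]axy buv !saddA.
have [s as_] := sandwich_absorbl qS ea.
have [t at_] := sandwich_absorbr qS ea.
have ac : a = (s + x) + (u + a) by rewrite [LHS]as_ !saddA.
exists (u + a); split.
- exact: add_regular_Lplus ra erefl ac.
- exact: Lplus_intro erefl ac.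
(* Adding [u] on the left of [a = a + (v + y + t)] gives [u + a = b + (y + t)]. *)
- by apply: (Rplus_intro (t := y + t) buv); rewrite buv {1}at_ !saddA.
Qed.

(** Lets a regular [c] related to multiples of [a] and [b] serve directly as the middle element for
    the starred relations. *)
Lemma least_regular1 a : add_regular a -> least_regular a 1.
Proof. by split. Qed.

Lemma star_sub (R R' : S -> S -> Prop) a b :
  (forall x y, R x y -> R' x y) -> star R a b -> star R' a b.
Proof. by move=> RR' [p [q [pa qb /RR' ab]]]; exists p, q. Qed.

Lemma Jstar_trans a b c : Jstar a b -> Jstar b c -> Jstar a c.
Proof.
move=> [p [q [pa qb ab]]] [q' [r [qb' rc bc]]]; exists p, r; split=> //.
(* The two least indices of [b] agree, so both hypotheses concern the same multiple of [b]. *)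
by rewrite -(least_regular_uniq qb qb') in bc; rewrite /Jplus ab.
Qed.

End AdditiveGreen.

Theorem theorem3p1 (S : semiring) (Y : blattice)
    (d : blattice_decomposition S Y)
    (hS : quasi_completely_regular S)
    (hY : forall alpha : Y, completely_archimedean (component d alpha)) :
  forall a b : S, Jstar a b <-> Dstar a b.
Proof.
move=> a b; split=> [[p [q [pa qb ab]]]|[c ac cb]].
- have [[_ ra _] [_ rb _]] := (pa, qb).
  have [c [rc ac cb]] := Jplus_regular_Dplus hS ra rb ab.
  by exists c; [exists p, 1%N | exists 1%N, q]; split=> //; exact: least_regular1.
(* Both starred one-sided relations lie in [Jstar], which is transitive. *)
- apply: (Jstar_trans (b := c)).
  + exact: star_sub (@Lplus_Jplus S) ac.
  + exact: star_sub (@Rplus_Jplus S) cb.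
Qed.
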